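(* Consider the following deterministic algorithm 1-MoWo, which uses one value query per agent. Given a preference profile $\succ$: compute the man-optimal stable matching $\mu_M^*$ and the woman-optimal stable matching $\mu_W^*$ of $\succ$; query each man $m$ for his value $v_m(\mu_M^*(m))$ and each woman $w$ for her value $v_w(\mu_W^*(w))$; output whichever of $\mu_M^*,\mu_W^*$ has the larger revealed social welfare with respect to the answers to these queries. Then the distortion of 1-MoWo is at most $2$.
   Context: Setting (stable matching): there are two disjoint sets of agents, men $M=\{m_1,\dots,m_n\}$ and women $W=\{w_1,\dots,w_n\}$. Every agent $a$ has a valuation function $v_a$ assigning a non-negative real value to each agent of the opposite side; $\mathbf{v}$ denotes the profile of all valuation functions (no normalization is imposed). A preference profile $\succ$ consists of a strict ranking $\succ_a$ of the opposite side for each agent $a$. It is consistent with (induced by) $\mathbf{v}$ if $b\succ_a b'$ implies $v_a(b)\ge v_a(b')$ (ties in values are broken arbitrarily to get strict rankings). A matching $\mu$ is a perfect one-to-one matching of $M$ and $W$; $\mu(a)$ is the partner of $a$. A pair $(m,w)$ is blocking for $\mu$ if $w\succ_m\mu(m)$ and $m\succ_w\mu(w)$. $\mu$ is stable if it has no blocking pair. $\mathcal{M}_s(\succ)$ is the set of stable matchings of $\succ$. The social welfare is $\mathrm{SW}(\mu\mid\mathbf{v})=\sum_{a\in M\cup W}v_a(\mu(a))$. Agents $a,b$ of opposite sides are stable partners if they are matched in some stable matching. The man-optimal (resp. woman-optimal) stable matching is the stable matching in which every man (resp. woman) is matched to the one he (resp. she) ranks highest among all his (resp. her) stable partners; both exist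 (Gale–Shapley). A value query to agent $a$ about an agent $b$ of the opposite side returns $v_a(b)$. Given the set of answers to the queries made, the revealed social welfare of a matching $\mu$ is the sum of $v_a(\mu(a))$ over those agents $a\in M\cup W$ for which the value $v_a(\mu(a))$ has been queried. The distortion of a query algorithm $\mathcal{A}$, which on input $\succ_{\mathbf{v}}$ and with query access to $\mathbf{v}$ outputs a stable matching $\mathcal{A}(\mathbf{v})$, is $$\mathrm{dist}(\mathcal{A})=\sup_{n,\mathbf{v}}\frac{\max_{\mu\in\mathcal{M}_s(\succ_{\mathbf{v}})}\mathrm{SW}(\mu\mid\mathbf{v})}{\mathrm{SW}(\mathcal{A}(\mathbf{v})\mid\mathbf{v})},$$ where the supremum is over all $n$, all valuation profiles $\mathbf{v}$ and preference profiles $\succ_{\mathbf{v}}$ consistent with $\mathbf{v}$, with the conventions $c/0=+\infty$ for $c>0$ and $0/0=1$. *)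

(* Defs.v *)
From HB Require Import structures.
From mathcomp Require Import all_boot all_order all_algebra all_fingroup.
From mathcomp Require Import all_classical all_reals all_analysis.

Set Implicit Arguments.
Unset Strict Implicit.
Unset Printing Implicit Defensive.

Import Order.TTheory GRing.Theory Num.Theory.
Local Open Scope ring_scope.

(* [inl i] is the man m_i and [inr j] is the woman w_j.  The agents of the side
   opposite to a given agent are always referred to by their index. *)
Notation agent n := ('I_n + 'I_n)%type.

(* The strict ranking of agent [a] is the permutation sending each agent of the
   opposite side to its position, position 0 being the most preferred. *)
Definition profile (n : nat) : Type := agent n -> 'S_n.

Definition prefers n (P : profile n) (a : agent n) (b b' : 'I_n) : bool :=
  (P a b < P a b')%N.

Definition valuation (R : realType) (n : nat) : Type := agent n -> 'I_n -> R.

Definition nonneg_valuation (R : realType) n (v : valuation R n) : Prop :=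
  forall a b, 0 <= v a b.

Definition consistent (R : realType) n (P : profile n) (v : valuation R n) : Prop :=
  forall a b b', prefers P a b b' -> v a b' <= v a b.

(* A matching is the permutation sending the index of each man to the index of
   his partner. *)
Definition partner n (mu : 'S_n) (a : agent n) : 'I_n :=
  match a with
  | inl m => mu m
  | inr w => (mu^-1)%g w
  end.

Definition blocking n (P : profile n) (mu : 'S_n) (m w : 'I_n) : bool :=
  prefers P (inl m) w (partner mu (inl m)) &&
  prefers P (inr w) m (partner mu (inr w)).

Definition stable n (P : profile n) (mu : 'S_n) : bool :=
  [forall m, forall w, ~~ blocking P mu m w].

Definition stable_partner n (P : profile n) (a : agent n) (b : 'I_n) : bool :=
  [exists mu : 'S_n, stable P mu && (partner mu a == b)].

Definition gets_best_stable_partner n (P : profile n) (mu : 'S_n) (a : agent n) : bool :=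
  [forall b, stable_partner P a b ==>
     (b == partner mu a) || prefers P a (partner mu a) b].

Definition man_optimal n (P : profile n) (mu : 'S_n) : bool :=
  stable P mu && [forall m, gets_best_stable_partner P mu (inl m)].

Definition woman_optimal n (P : profile n) (mu : 'S_n) : bool :=
  stable P mu && [forall w, gets_best_stable_partner P mu (inr w)].

(* Matchings with these properties exist (Gale-Shapley) and are unique, so the
   default value of [odflt] is never used. *)
Definition man_opt n (P : profile n) : 'S_n :=
  odflt 1%g [pick mu | man_optimal P mu].

Definition woman_opt n (P : profile n) : 'S_n :=
  odflt 1%g [pick mu | woman_optimal P mu].

Definition SW (R : realType) n (v : valuation R n) (mu : 'S_n) : R :=
  \sum_(a : agent n) v a (partner mu a).

Notation query n := (agent n * 'I_n)%type.

(* A deterministic, possibly adaptive, computation with query access to the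
   valuations: [Ask (a, b) k] asks for [v a b] and continues with the answer. *)
Inductive query_tree (R : realType) (n : nat) : Type :=
| Output of 'S_n
| Ask of query n & (R -> query_tree R n).
Arguments Output {R n} _.

Fixpoint run (R : realType) n (v : valuation R n) (t : query_tree R n) : 'S_n :=
  match t with
  | Output mu => mu
  | Ask q k => run v (k (v q.1 q.2))
  end.

Fixpoint queries_made (R : realType) n (v : valuation R n) (t : query_tree R n)
    : seq (query n) :=
  match t with
  | Output _ => [::]
  | Ask q k => q :: queries_made v (k (v q.1 q.2))
  end.

Definition query_algorithm (R : realType) : Type :=
  forall n, profile n -> query_tree R n.

(* [None] means that the query has not been made. *)
Definition answers (R : realType) (n : nat) : Type := query n -> option R.

Definition record_answer (R : realType) n (ans : answers R n) (q : query n) (x : R)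
    : answers R n :=
  fun q' => if q' == q then Some x else ans q'.

Fixpoint ask_all (R : realType) n (qs : seq (query n)) (ans : answers R n)
    (k : answers R n -> query_tree R n) : query_tree R n :=
  match qs with
  | [::] => k ans
  | q :: qs' => Ask q (fun x => ask_all qs' (record_answer ans q x) k)
  end.

Definition revealed_SW (R : realType) n (ans : answers R n) (mu : 'S_n) : R :=
  \sum_(a : agent n) odflt 0 (ans (a, partner mu a)).

(* How the algorithm chooses between two matchings of equal revealed welfare;
   [true] selects the man-optimal one. *)
Definition tie_rule (R : realType) : Type :=
  forall n, profile n -> answers R n -> bool.

Definition mowo_query n (P : profile n) (a : agent n) : query n :=
  match a with
  | inl _ => (a, partner (man_opt P) a)
  | inr _ => (a, partner (woman_opt P) a)
  end.

Definition mowo_choice (R : realType) (tie : tie_rule R) n (P : profile n)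
    (ans : answers R n) : 'S_n :=
  let rM := revealed_SW ans (man_opt P) in
  let rW := revealed_SW ans (woman_opt P) in
  if rW < rM then man_opt P
  else if rM < rW then woman_opt P
  else if tie n P ans then man_opt P else woman_opt P.

Definition one_MoWo (R : realType) (tie : tie_rule R) : query_algorithm R :=
  fun n P => ask_all [seq mowo_query P a | a : agent n] (fun=> None)
               (fun ans => Output (mowo_choice tie P ans)).

Lemma queries_made_ask_all (R : realType) n (v : valuation R n) qs ans k :
  (forall ans', queries_made v (k ans') = [::]) ->
  queries_made v (ask_all qs ans k) = qs.
Proof. by move=> k0; elim: qs ans => [|q qs IH] ans //=; rewrite IH. Qed.

Lemma one_MoWo_one_query_per_agent (R : realType) (tie : tie_rule R) n
    (P : profile n) (v : valuation R n) :
  [seq q.1 | q <- queries_made v (one_MoWo tie P)] = enum {: agent n}.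
Proof.
rewrite queries_made_ask_all // -map_comp -[RHS]map_id.
by apply: eq_map => -[].
Qed.

Definition max_stable_SW (R : realType) n (P : profile n) (v : valuation R n) : R :=
  \big[Num.max/0]_(mu : 'S_n | stable P mu) SW v mu.

(* c / d with c / 0 = +oo for c > 0 and 0 / 0 = 1 *)
Definition welfare_ratio (R : realType) (c d : R) : \bar R :=
  if d == 0 then (if c == 0 then 1%:E else +oo%E) else (c / d)%:E.

Definition distortion (R : realType) (A : query_algorithm R) : \bar R :=
  ereal_sup [set r : \bar R | exists (n : nat) (v : valuation R n) (P : profile n),
    [/\ nonneg_valuation v, consistent P v
      & r = welfare_ratio (max_stable_SW P v) (SW v (run v (A n P)))]]%classic.

(* Main.v *)
Require Import Defs.
From HB Require Import structures.
From mathcomp Require Import all_boot all_order all_algebra all_fingroup.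
From mathcomp Require Import all_classical all_reals all_analysis.
From mathcomp Require Import lra.

(* The men's welfare [A] under the man-optimal matching and the women's welfare
   [B] under the woman-optimal one are entirely revealed, and every stable
   matching has welfare at most [A + B], because each agent does best in the
   optimal matching of its side.  The matching that is output has revealed
   welfare at least [max A B], hence welfare at least [(A + B) / 2].

   The optimal matchings exist by deferred acceptance, run here as an extremal
   argument: among the proposal maps that satisfy the invariant of the
   men-proposing algorithm, one whose proposals are furthest down the men's
   lists is injective, hence a man-optimal matching. *)

Import Order.TTheory GRing.Theory Num.Theory.
Local Open Scope ring_scope.

(** Exchanging the two sides turns a matching into its inverse, so woman-optimal matchings come from
    man-optimal ones of the swapped profile. *)
Definition swap_agent {n} (a : agent n) : agent n :=
  match a with inl i => inr i | inr i => inl i end.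

Definition swap_sides {n} (P : profile n) : profile n :=
  fun a => P (swap_agent a).

Lemma partnerV {n} (mu : 'S_n) (a : agent n) :
  partner (mu^-1)%g a = partner mu (swap_agent a).
Proof. by case: a => i //=; rewrite invgK. Qed.

Lemma stable_swap {n} (P : profile n) (mu : 'S_n) :
  stable (swap_sides P) (mu^-1)%g = stable P mu.
Proof.
apply/forallP/forallP => h i; apply/forallP => j.
  by have /forallP/(_ i) := h j; rewrite /blocking !partnerV andbC.
by have /forallP/(_ i) := h j; rewrite /blocking !partnerV andbC.
Qed.

Lemma gets_best_swap {n} (P : profile n) (mu : 'S_n) (a : agent n) :
  gets_best_stable_partner (swap_sides P) (mu^-1)%g (swap_agent a) =
  gets_best_stable_partner P mu a.
Proof.
have swapK : swap_agent (swap_agent a) = a by case: a.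
apply: eq_forallb => b; rewrite partnerV swapK /prefers /swap_sides swapK.
congr (_ ==> _); apply/existsP/existsP => -[nu /andP[snu /eqP <-]];
  exists (nu^-1)%g; rewrite partnerV ?swapK eqxx andbT.
  by rewrite -stable_swap invgK.
by rewrite stable_swap.
Qed.

Lemma man_optimal_swap {n} (P : profile n) (mu : 'S_n) :
  man_optimal (swap_sides P) (mu^-1)%g = woman_optimal P mu.
Proof.
rewrite /man_optimal stable_swap; congr (_ && _).
by apply: eq_forallb => i; exact: (gets_best_swap P mu (inr i)).
Qed.

Section DeferredAcceptance.
Context {n : nat} (P : profile n).

Definition man_rank (m w : 'I_n) : 'I_n := P (inl m) w.

(* [f m] is the current proposal of [m]: no stable partner has rejected [m],
   and a woman who has rejected [m] currently holds a proposal she prefers. *)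
Definition proposal_invariant (f : {ffun 'I_n -> 'I_n}) : Prop :=
  (forall mu, stable P mu -> forall m, (man_rank m (f m) <= man_rank m (mu m))%N)
  /\ (forall m w, (man_rank m w < man_rank m (f m))%N ->
        exists2 m', f m' = w & prefers P (inr w) m' m).

(** As ['I_n] may be empty, position 0 is built from the man [m] himself. *)
Definition first_proposals : {ffun 'I_n -> 'I_n} :=
  [ffun m => ((P (inl m))^-1)%g (Ordinal (leq_ltn_trans (leq0n m) (ltn_ord m)))].

Lemma first_proposals_invariant : proposal_invariant first_proposals.
Proof. by split=> [mu _ m|m w]; rewrite /man_rank ffunE permKV. Qed.

(** No stable [mu] gives [m2] the woman who now rejects him: [m1] would block with her, since by the
    invariant he ranks [f m1] at least as high as [mu m1], and these two women differ. *)
Lemma proposal_advance {f : {ffun 'I_n -> 'I_n}} {m1 m2 w' : 'I_n} :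
  proposal_invariant f -> f m1 = f m2 ->
  prefers P (inr (f m2)) m1 m2 ->
  man_rank m2 w' = (man_rank m2 (f m2)).+1 :> nat ->
  proposal_invariant [ffun m => if m == m2 then w' else f m].
Proof.
move=> [Iopt Irej] f12 pref12 rw'.
have m12 : m1 != m2 by apply/eqP => e; move: pref12; rewrite e /prefers ltnn.
split=> [mu smu m|m w]; rewrite ffunE.
  case: eqVneq => [->|_]; last exact: Iopt.
  rewrite rw' ltn_neqAle Iopt // andbT.
  apply/eqP => /val_inj/perm_inj fm2.
  have /forallP/(_ m1)/forallP/(_ (f m2))/negP := smu; apply.
  apply/andP; split=> /=; last by rewrite [in X in prefers _ _ _ X]fm2 permK.
  rewrite /prefers ltn_neqAle -f12 -/(man_rank _ _) -/(man_rank _ _) Iopt // andbT.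
  apply/eqP => /val_inj/perm_inj; rewrite f12 fm2 => /perm_inj/eqP.
  by rewrite eq_sym (negPf m12).
(* A woman who loses the proposal of [m2] still holds that of [m1], whom she likes even better. *)
have keep m3 : f m3 = w -> prefers P (inr w) m3 m ->
    exists2 m', [ffun m0 => if m0 == m2 then w' else f m0] m' = w &
      prefers P (inr w) m' m.
  move=> fm3 p3; case: (eqVneq m3 m2) => [e|ne]; last first.
    by exists m3; rewrite // ffunE (negPf ne).
  exists m1; first by rewrite ffunE (negPf m12) f12 -e.
  by apply: ltn_trans p3; rewrite -fm3 e; exact: pref12.
case: (eqVneq m m2) keep => [->|_] keep; last by move=> /Irej[m3]; exact: keep.
rewrite rw' ltnS leq_eqVlt => /orP[/eqP/val_inj/perm_inj ew|/Irej[m3]].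
  by apply: (keep m1); rewrite ew.
exact: keep.
Qed.

(** Some woman [w0] holds no proposal, so by the invariant she has rejected nobody. Hence [m] ranks
    her strictly below [f m], which is therefore not last on his list. *)
Lemma proposal_next {f : {ffun 'I_n -> 'I_n}} (m : 'I_n) :
  proposal_invariant f -> ~ injective f ->
  exists w', man_rank m w' = (man_rank m (f m)).+1 :> nat.
Proof.
case=> _ Irej ninj.
have [w0 w0f] : exists w0, w0 \notin codom f.
  apply/existsP; rewrite -negb_forall; apply/negP => /forallP surj.
  apply: ninj; apply/injectiveP; rewrite /injectiveb /dinjectiveb.
  by apply/card_uniqP; rewrite size_map -cardT; apply: eq_card => w; rewrite surj.
suff lt : ((man_rank m (f m)).+1 < n)%N.
  by exists (((P (inl m))^-1)%g (Ordinal lt)); rewrite /man_rank permKV.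
apply: leq_ltn_trans (ltn_ord (man_rank m w0)).
rewrite ltn_neqAle; apply/andP; split.
  by apply/eqP => /val_inj/perm_inj e; rewrite -e codom_f in w0f.
by rewrite leqNgt; apply/negP => /Irej[m' e _]; rewrite -e codom_f in w0f.
Qed.

Lemma injective_proposals :
  exists2 f, proposal_invariant f & injective f.
Proof.
have inv0 : `[< proposal_invariant first_proposals >].
  by apply/asboolP; exact: first_proposals_invariant.
case: (@arg_maxnP _ _ (fun f => `[< proposal_invariant f >])
  (fun f : {ffun 'I_n -> 'I_n} => \sum_m man_rank m (f m))%N inv0)
  => f /asboolP If fmax.
exists f => //; apply: contrapT => ninj.
have [m1 [m2 [f12 m12]]] : exists m1 m2, f m1 = f m2 /\ m1 != m2.
  apply: contrapT => h; apply: ninj => m1 m2 f12.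
  apply/eqP; apply: contrapT => /negP ne.
  by apply: h; exists m1, m2.
(* Let [m2] be the suitor she rejects; advancing him increases the sum of ranks. *)
wlog pref : m1 m2 f12 m12 / prefers P (inr (f m2)) m1 m2.
  move=> H; case: (ltngtP (P (inr (f m2)) m1) (P (inr (f m2)) m2)) => [|gt|].
  - exact: H.
  - by apply: (H m2 m1); rewrite // ?f12 // eq_sym.
  - by move=> /val_inj/perm_inj e; rewrite e eqxx in m12.
have [w' rw'] := proposal_next m2 If ninj.
have /asboolP/fmax := proposal_advance If f12 pref rw'.
rewrite /geq /= leqNgt => /negP; apply.
rewrite (bigD1 m2) //= [X in (_ < X)%N](bigD1 m2) //= ffunE eqxx rw' addSn ltnS.
rewrite leq_add2l; apply: leq_sum => m ne.
by rewrite ffunE (negPf ne).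
Qed.

(** Once proposals are injective, the rejection clause of the invariant rules out blocking pairs,
    and the other clause gives optimality. *)
Lemma man_optimal_exists : exists mu, man_optimal P mu.
Proof.
have [f [Iopt Irej] inj] := injective_proposals.
exists (perm inj); apply/andP; split.
  apply/forallP => m; apply/forallP => w; apply/negP => /andP[/=].
  rewrite permE => /Irej[m' fm' p1] p2.
  have e : ((perm inj)^-1)%g w = m' by rewrite -fm' -(permE inj) permK.
  by move: (ltn_trans p1 p2); rewrite e ltnn.
apply/forallP => m; apply/forallP => b; apply/implyP.
move=> /existsP[mu /andP[smu /eqP <-]] /=.
have := Iopt mu smu m; rewrite leq_eqVlt permE /prefers.
case/orP=> [|->]; last by rewrite orbT.
by move=> /eqP/val_inj/perm_inj->; rewrite eqxx.
Qed.

End DeferredAcceptance.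

Lemma man_opt_optimal {n} (P : profile n) : man_optimal P (man_opt P).
Proof.
rewrite /man_opt; case: pickP => //= none.
by have [mu] := man_optimal_exists P; rewrite none.
Qed.

Lemma woman_opt_optimal {n} (P : profile n) : woman_optimal P (woman_opt P).
Proof.
rewrite /woman_opt; case: pickP => //= none.
have [mu] := man_optimal_exists (swap_sides P).
by rewrite -[mu]invgK man_optimal_swap none.
Qed.

Lemma gets_best_value {R : realType} {n} (P : profile n) (v : valuation R n)
    (mu nu : 'S_n) (a : agent n) :
  consistent P v -> gets_best_stable_partner P mu a -> stable P nu ->
  v a (partner nu a) <= v a (partner mu a).
Proof.
move=> Pv /forallP/(_ (partner nu a))/implyP best snu.
have /best/orP[/eqP->//|/Pv//] : stable_partner P a (partner nu a).
by apply/existsP; exists nu; rewrite snu eqxx.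
Qed.

Lemma run_ask_all {R : realType} {n} (v : valuation R n) qs ans k :
  run v (ask_all qs ans k) =
  run v (k (fun q => if q \in qs then Some (v q.1 q.2) else ans q)).
Proof.
elim: qs ans => [|q qs IH] ans //=.
rewrite IH; congr (run v (k _)); apply/funext => q'.
(* A query repeated in [qs] is recorded again with the same answer. *)
rewrite inE /record_answer; case: (eqVneq q' q) => [->|_] //=.
by case: ifP.
Qed.

Section RevealedWelfare.
Context {R : realType} {n : nat} (v : valuation R n) (qs : seq (query n)).
Hypothesis v0 : nonneg_valuation v.

Let ans : answers R n :=
  fun q => if q \in qs then Some (v q.1 q.2) else None.

Lemma revealed_SW_le (mu : 'S_n) : revealed_SW ans mu <= SW v mu.
Proof. by apply: ler_sum => a _; rewrite /ans; case: ifP => //= _; apply: v0. Qed.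

(** Meant for [f] equal to [inl] or [inr]: the queried side counts in full, and the other agents
    reveal nonnegative amounts. *)
Lemma revealed_SW_ge (f : 'I_n -> agent n) (mu : 'S_n) :
  injective f -> (forall i, (f i, partner mu (f i)) \in qs) ->
  \sum_i v (f i) (partner mu (f i)) <= revealed_SW ans mu.
Proof.
move=> injf fqs.
rewrite /revealed_SW (bigID [in codom f]) /=.
rewrite -[leLHS]addr0 lerD //; last first.
  by apply: sumr_ge0 => a _; rewrite /ans; case: ifP => //= _; apply: v0.
have uf : uniq (codom f) by apply/injectiveP; exact: injf.
rewrite -(big_uniq _ uf) /=.
rewrite /codom /image_mem big_map big_enum /=.
by apply: ler_sum => i _; rewrite /ans fqs.
Qed.

End RevealedWelfare.

Lemma SW_le_double {R : realType} (tie : tie_rule R) {n} (P : profile n)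
    (v : valuation R n) (nu : 'S_n) :
  nonneg_valuation v -> consistent P v -> stable P nu ->
  SW v nu <= 2 * SW v (run v (one_MoWo tie P)).
Proof.
move=> v0 Pv snu; rewrite /one_MoWo run_ask_all /=.
set qs := [seq _ | _ : _]; set ans := fun q => _.
have queried a : mowo_query P a \in qs by apply: map_f; rewrite mem_enum.
have /andP[_ /forallP bestM] := man_opt_optimal P.
have /andP[_ /forallP bestW] := woman_opt_optimal P.
have geM := revealed_SW_ge v qs v0 inl (man_opt P) inl_inj
  (fun i => queried (inl i)).
have geW := revealed_SW_ge v qs v0 inr (woman_opt P) inr_inj
  (fun i => queried (inr i)).
have leM := revealed_SW_le v qs v0 (man_opt P).
have leW := revealed_SW_le v qs v0 (woman_opt P).
have : SW v nu <= \sum_i v (inl i) (partner (man_opt P) (inl i)) +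
                  \sum_i v (inr i) (partner (woman_opt P) (inr i)).
  rewrite /SW big_sumType.
  by apply: lerD; apply: ler_sum => i _; exact: (gets_best_value P v _ _ _ Pv).
rewrite -/ans in geM geW leM leW.
(* In every branch, ties included, the revealed welfare of the output is at least each of the two
   sums. *)
rewrite /mowo_choice; case: ltP => ?; last case: ltP => ?; last case: ifP => _; lra.
Qed.

Lemma max_stable_SW_le {R : realType} {n} (P : profile n) (v : valuation R n)
    (c : R) :
  0 <= c -> (forall nu, stable P nu -> SW v nu <= c) -> max_stable_SW P v <= c.
Proof.
move=> c0 h; rewrite /max_stable_SW.
by elim/big_ind: _ => // x y; rewrite ge_max => -> ->.
Qed.

(** The bound [c <= k * d] excludes the infinite case, and [1 <= k] covers the convention that 0/0
    is 1. *)
Lemma welfare_ratio_le {R : realType} (c d k : R) :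
  0 <= c -> 0 <= d -> 1 <= k -> c <= k * d -> (welfare_ratio c d <= k%:E)%E.
Proof.
move=> c0 d0 k1 cd; rewrite /welfare_ratio; case: eqVneq => [d_eq0|dn0].
  have -> : c == 0 by rewrite eq_le c0 andbT; rewrite d_eq0 mulr0 in cd.
  by rewrite lee_fin.
by rewrite lee_fin ler_pdivrMr // lt0r dn0.
Qed.

Theorem theorem4p1 (R : realType) (tie : tie_rule R) :
  (distortion (one_MoWo tie) <= 2%:E)%E.
Proof.
apply: ge_ereal_sup => _ [n [v [P [v0 Pv ->]]]].
have SW0 mu : 0 <= SW v mu by apply: sumr_ge0.
apply: welfare_ratio_le => //; first 1 last.
- by rewrite ler1n.
- by apply: max_stable_SW_le => [|nu]; [rewrite mulr_ge0|exact: SW_le_double].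
by rewrite /max_stable_SW; elim/big_ind: _ => // x y x0 y0; rewrite le_max x0.
Qed.
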